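(* Let $\varepsilon\in\{+,-\}$ and $\boldsymbol\lambda\in\mathcal P_{n,r}$. Then $P^{\varepsilon}_{\boldsymbol\lambda}(x;\mathbf t)$ is the unique element $F\in\Xi^n_{\mathbb Q}(\mathbf t)$ such that (i) $F=\sum_{\boldsymbol\mu\succeq\boldsymbol\lambda}c_{\boldsymbol\lambda,\boldsymbol\mu}(\mathbf t)q^{\varepsilon}_{\boldsymbol\mu}(x;\mathbf t)$ with $c_{\boldsymbol\lambda,\boldsymbol\mu}(\mathbf t)\in\mathbb Q(\mathbf t)$ and $c_{\boldsymbol\lambda,\boldsymbol\lambda}(\mathbf t)\ne0$, and (ii) $F=\sum_{\boldsymbol\mu\preceq\boldsymbol\lambda}u_{\boldsymbol\lambda,\boldsymbol\mu}(\mathbf t)s_{\boldsymbol\mu}(x)$ with $u_{\boldsymbol\lambda,\boldsymbol\mu}(\mathbf t)\in\mathbb Q(\mathbf t)$ and $u_{\boldsymbol\lambda,\boldsymbol\lambda}(\mathbf t)=1$. Likewise $Q^{\varepsilon}_{\boldsymbol\lambda}(x;\mathbf t)$ is the unique element satisfying (i) and (ii) with the normalizations replaced by $c_{\boldsymbol\lambda,\boldsymbol\lambda}(\mathbf t)=1$ and $u_{\boldsymbol\lambda,\boldsymbol\lambda}(\mathbf t)\ne0$.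
   Context: Fix an integer $r\ge 2$. Let $x=(x^{(1)},\dots,x^{(r)})$, each $x^{(k)}=(x^{(k)}_1,x^{(k)}_2,\dots)$ an infinite family of variables; upper indices mod $r$ in $\{1,\dots,r\}$. $\Xi^n$ is the $\mathbb Z$-module of homogeneous degree-$n$ functions symmetric in each $x^{(k)}$ separately. $\mathbf t=(t_1,\dots,t_r)$ indeterminates, lower indices mod $r$ in $\{1,\dots,r\}$ ($t_0$ means $t_r$); $\Xi^n_{\mathbb Q}(\mathbf t)=\mathbb Q(\mathbf t)\otimes\Xi^n$. $\mathcal A\subset\mathbb Q(\mathbf t)$ is the subring of $f/g$ with $g(0,\dots,0)\ne0$, $\Xi^n_{\mathcal A}=\mathcal A\otimes\Xi^n$. $\mathcal P_{n,r}$: $r$-tuples $\boldsymbol\lambda=(\lambda^{(1)},\dots,\lambda^{(r)})$ of partitions with $\sum_k|\lambda^{(k)}|=n$; $s_{\boldsymbol\lambda}=\prod_ks_{\lambda^{(k)}}(x^{(k)})$, $m_{\boldsymbol\lambda}=\prod_km_{\lambda^{(k)}}(x^{(k)})$. Define $q^{(k)}_{s,\pm}(x;t)$ by $\sum_{s\ge0}q^{(k)}_{s,\pm}(x;t)u^s=\prod_{i\ge1}\frac{1-tux^{(k\mp1)}_i}{1-ux^{(k)}_i}$, and $q^{+}_{\boldsymbol\lambda}=\prod_{k}\prod_{i}q^{(k)}_{\lambda^{(k)}_i,+}(x;t_{k-1})$, $q^{-}_{\boldsymbol\lambda}=\prod_k\prod_iq^{(k)}_{\lambda^{(k)}_i,-}(x;t_k)$.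 $\langle\ ,\ \rangle$ is the $\mathbb Q(\mathbf t)$-bilinear form on $\Xi^n_{\mathbb Q}(\mathbf t)$ with $\langle q^+_{\boldsymbol\lambda},m_{\boldsymbol\mu}\rangle=\delta_{\boldsymbol\lambda,\boldsymbol\mu}$. Dominance order: with $m\ge$ all lengths, $c(\boldsymbol\lambda)=(\lambda^{(1)}_1,\dots,\lambda^{(r)}_1,\lambda^{(1)}_2,\dots,\lambda^{(r)}_2,\dots,\lambda^{(1)}_m,\dots,\lambda^{(r)}_m)$ and $\boldsymbol\lambda\le\boldsymbol\mu$ iff all partial sums of $c(\boldsymbol\lambda)$ are $\le$ those of $c(\boldsymbol\mu)$. Fix a total order $\preceq$ on $\mathcal P_{n,r}$ refining $\le$. The Hall–Littlewood functions $P^{\pm}_{\boldsymbol\lambda}(x;\mathbf t)$ are the unique family in $\Xi^n_{\mathcal A}$ with: $P^\pm_{\boldsymbol\lambda}=s_{\boldsymbol\lambda}+\sum_{\boldsymbol\mu\prec\boldsymbol\lambda}u^\pm_{\boldsymbol\lambda\boldsymbol\mu}s_{\boldsymbol\mu}$ ($u^\pm_{\boldsymbol\lambda\boldsymbol\mu}\in\mathcal A$), $\langle P^+_{\boldsymbol\lambda},P^-_{\boldsymbol\mu}\rangle=0$ for $\boldsymbol\lambda\ne\boldsymbol\mu$, and $P^\pm_{\boldsymbol\lambda}(x;0,\dots,0)=s_{\boldsymbol\lambda}$. Put $b_{\boldsymbol\lambda}(\mathbf t)=\langle P^+_{\boldsymbol\lambda},P^-_{\boldsymbol\lambda}\rangle^{-1}$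 (which is nonzero) and $Q^\pm_{\boldsymbol\lambda}=b_{\boldsymbol\lambda}(\mathbf t)P^\pm_{\boldsymbol\lambda}$. *)

(* Defs.v *)
From HB Require Import structures.
From mathcomp Require Import all_boot all_order all_algebra.
Set Implicit Arguments. Unset Strict Implicit. Unset Printing Implicit Defensive.
Import GRing.Theory.
Local Open Scope ring_scope.

Fixpoint mpoly (r : nat) : idomainType :=
  if r is r'.+1 then GRing.IntegralDomain.clone {poly mpoly r'} _ else rat.

(* the indeterminate t_{j+1} (0-based index j < r) *)
Fixpoint tvar (r j : nat) : mpoly r :=
  match r return mpoly r with
  | 0 => 0
  | r'.+1 => if j == r' then 'X else (tvar r' j)%:P
  end.

Fixpoint ev0 (r : nat) : mpoly r -> rat :=
  match r return mpoly r -> rat with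
  | 0 => fun x => x
  | r'.+1 => fun p => ev0 (p`_0)
  end.

Definition Qt (r : nat) := {fraction mpoly r}.

Definition tv (r : nat) (j : 'I_r) : Qt r := tofrac (tvar r j).

Definition inA (r : nat) (a : Qt r) : Prop :=
  exists f g : mpoly r, ev0 g != 0 /\ a = tofrac f / tofrac g.

Definition at0 (r : nat) (a : Qt r) (c : rat) : Prop :=
  exists f g : mpoly r, [/\ ev0 g != 0, a = tofrac f / tofrac g & c = ev0 f / ev0 g].

(* r-tuples of partitions of total size n.  Family k (0-based, k < r)  *)
(* corresponds to the upper index k+1; a partition is stored as a      *)
(* nonincreasing n-tuple of parts, padded with zeros (length <= n).    *)
Definition mpart_raw (n r : nat) := {ffun 'I_r -> n.-tuple 'I_n.+1}.

Definition is_mpart (n r : nat) (l : mpart_raw n r) : bool :=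
  [forall k : 'I_r, forall i : 'I_n, forall j : 'I_n,
      (i <= j)%N ==> (tnth (l k) j <= tnth (l k) i)%N]
  && ((\sum_(k < r) \sum_(i < n) nat_of_ord (tnth (l k) i))%N == n).

Definition mpart (n r : nat) := {l : mpart_raw n r | is_mpart l}.

(* lambda^{(k+1)}_{i+1} *)
Definition part (n r : nat) (l : mpart n r) (k : 'I_r) (i : 'I_n) : nat :=
  tnth (val l k) i.

Definition cseq (n r : nat) (l : mpart n r) : seq nat :=
  [seq part l k i | i <- enum 'I_n, k <- enum 'I_r].

Definition dominated (n r : nat) (l m : mpart n r) : Prop :=
  forall p : nat, (sumn (take p (cseq l)) <= sumn (take p (cseq m)))%N.

Definition total_refining (n r : nat) (ord : rel (mpart n r)) : Prop :=
  [/\ reflexive ord, antisymmetric ord, transitive ord, total ord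
    & forall l m, dominated l m -> ord l m].

(* Xi^n_{Q(t)}: an element is given by its coordinates in the Z-basis  *)
(* (m_lambda) of Xi^n, i.e. F = sum_nu F nu * m_nu.                     *)
(* The coordinate F nu is the coefficient of the monomial x^nu, where  *)
(* x^nu = prod_k prod_i (x^{(k)}_i)^{nu^{(k)}_i}.                       *)
Definition Xi (n r : nat) := {ffun mpart n r -> Qt r}.

Definition lincomb (n r : nat) (c : mpart n r -> Qt r) (B : mpart n r -> Xi n r)
  : Xi n r := [ffun nu => \sum_mu c mu * B mu nu].

(* A tableau of shape lam (a partition, padded) with entries in {1..n}  *)
(* (entry a : 'I_n stands for the variable x_{a+1}); cells (i,j) with   *)
(* row i, column j.  Only variables x_1..x_n matter for the coefficient *)
(* of x^nu when nu has length <= n.                                     *)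
Definition in_shape (n : nat) (lam : n.-tuple 'I_n.+1) (c : 'I_n * 'I_n) : bool :=
  (c.2 < tnth lam c.1)%N.

Definition ssyt (n : nat) (lam : n.-tuple 'I_n.+1) (T : {ffun 'I_n * 'I_n -> 'I_n})
  : bool :=
  [forall c, ~~ in_shape lam c ==> (nat_of_ord (T c) == 0)%N]
  && [forall c, forall d,
        [&& in_shape lam c, in_shape lam d, c.1 == d.1 & (c.2 < d.2)%N]
          ==> (T c <= T d)%N]
  && [forall c, forall d,
        [&& in_shape lam c, in_shape lam d, c.2 == d.2 & (c.1 < d.1)%N]
          ==> (T c < T d)%N].

Definition has_content (n : nat) (lam : n.-tuple 'I_n.+1) (T : {ffun 'I_n * 'I_n -> 'I_n})
  (nu : n.-tuple 'I_n.+1) : bool :=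
  [forall a : 'I_n, #|[set c | in_shape lam c & T c == a]| == tnth nu a].

Definition kostka (n : nat) (lam nu : n.-tuple 'I_n.+1) : nat :=
  #|[set T | ssyt lam T && has_content lam T nu]|.

(* s_lambda = prod_k s_{lambda^{(k)}}(x^{(k)}) *)
Definition schurc (n r : nat) (l nu : mpart n r) : nat :=
  \prod_(k < r) kostka (val l k) (val nu k).

Definition schur (n r : nat) (l : mpart n r) : Xi n r :=
  [ffun nu : mpart n r => (schurc l nu)%:R].

(* Exponent vectors alpha : (k,i) |-> exponent of x^{(k)}_i, for i < n  *)
(* and exponents <= n (all that is relevant in degree n).  Coefficient  *)
(* functions on exponent vectors multiply by convolution.               *)
Definition expo (n r : nat) := {ffun 'I_r * 'I_n -> 'I_n.+1}.
Definition ser (n r : nat) := expo n r -> Qt r.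

Definition sone (n r : nat) : ser n r :=
  fun g => if [forall c, nat_of_ord (g c) == 0%N] then 1 else 0.

Definition smul (n r : nat) (f g : ser n r) : ser n r :=
  fun gam => \sum_(a : expo n r | [forall c, (a c <= gam c)%N])
               f a * g [ffun c => inord (gam c - a c)].

(* eps = true is "+", eps = false is "-".                                *)
(* q^{(k)}_{s,+}(x;t): generating function prod_i (1 - t u x^{(k-1)}_i)  *)
(*                                            / (1 - u x^{(k)}_i),        *)
(* q^{(k)}_{s,-}(x;t): same with x^{(k+1)}.  Its coefficient of x^alpha   *)
(* (with u^s) is (-t)^{|alpha^{(k-+1)}|} if alpha is supported on the two *)
(* families k, k-+1, alpha^{(k-+1)} is a 0/1 vector and |alpha| = s,     *)
(* and 0 otherwise.                                                      *)
Definition nbr (r : nat) (eps : bool) (k : 'I_r) : 'I_r :=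
  if eps then ord_pred k else ordS k.

Definition qfac (n r : nat) (eps : bool) (k : 'I_r) (t : Qt r) (s : nat) : ser n r :=
  fun a =>
    let kk := nbr eps k in
    if [forall c : 'I_r * 'I_n, (c.1 != k) && (c.1 != kk) ==> (nat_of_ord (a c) == 0%N)]
       && [forall i : 'I_n, (a (kk, i) <= 1)%N]
       && ((\sum_(i < n) a (kk, i) + \sum_(i < n) a (k, i))%N == s)
    then (- t) ^+ (\sum_(i < n) a (kk, i))%N else 0.

(* t-parameter: t_{k-1} for "+", t_k for "-" (upper index k = k0+1) *)
Definition qpar (r : nat) (eps : bool) (k : 'I_r) : Qt r :=
  tv (if eps then ord_pred k else k).

Definition qser (n r : nat) (eps : bool) (l : mpart n r) : ser n r :=
  \big[@smul n r/@sone n r]_(c : 'I_r * 'I_n) @qfac n r eps c.1 (qpar eps c.1) (part l c.1 c.2).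

Definition expo_of (n r : nat) (nu : mpart n r) : expo n r :=
  [ffun c => tnth (val nu c.1) c.2].

Definition qfun (n r : nat) (eps : bool) (l : mpart n r) : Xi n r :=
  [ffun nu => qser eps l (expo_of nu)].

(* ---- the bilinear form with <q^+_lambda, m_mu> = delta ---- *)
Definition Nm (n r : nat) := #|{: mpart n r}|.

Definition qmat (n r : nat) : 'M[Qt r]_(Nm n r) :=
  \matrix_(i, j) qfun true (enum_val i) (enum_val j).

Definition qcoord (n r : nat) (F : Xi n r) (l : mpart n r) : Qt r :=
  ((\row_j F (enum_val j)) *m invmx (qmat n r)) 0 (enum_rank l).

Definition form (n r : nat) (F G : Xi n r) : Qt r :=
  \sum_l qcoord F l * G l.

Definition HLsel (n r : nat) (Pp Pm : mpart n r -> Xi n r) (eps : bool) :=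
  if eps then Pp else Pm.

Definition is_HL (n r : nat) (ord : rel (mpart n r)) (Pp Pm : mpart n r -> Xi n r)
  : Prop :=
  [/\ forall eps l, exists u : mpart n r -> Qt r,
        [/\ forall m, inA (u m),
            u l = 1,
            forall m, u m != 0 -> ord m l
          & HLsel Pp Pm eps l = lincomb u (@schur n r)],
      forall l m, l != m -> form (Pp l) (Pm m) = 0
    & forall eps l nu, at0 (HLsel Pp Pm eps l nu) (schurc l nu)%:R].

Definition bHL (n r : nat) (Pp Pm : mpart n r -> Xi n r) (l : mpart n r) : Qt r :=
  (form (Pp l) (Pm l))^-1.

Definition QHL (n r : nat) (Pp Pm : mpart n r -> Xi n r) (eps : bool) (l : mpart n r)
  : Xi n r := [ffun nu => bHL Pp Pm l * HLsel Pp Pm eps l nu].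

Definition cond_i (n r : nat) (ord : rel (mpart n r)) (eps : bool) (l : mpart n r)
  (F : Xi n r) (norm : Qt r -> Prop) : Prop :=
  exists c : mpart n r -> Qt r,
    [/\ forall m, c m != 0 -> ord l m, norm (c l) & F = lincomb c (qfun eps)].

Definition cond_ii (n r : nat) (ord : rel (mpart n r)) (l : mpart n r)
  (F : Xi n r) (norm : Qt r -> Prop) : Prop :=
  exists u : mpart n r -> Qt r,
    [/\ forall m, u m != 0 -> ord m l, norm (u l) & F = lincomb u (@schur n r)].

(* Main.v *)
Require Import Defs.
From HB Require Import structures.
From mathcomp Require Import all_boot all_order all_algebra.
Set Implicit Arguments. Unset Strict Implicit. Unset Printing Implicit Defensive.
Import Order.TTheory GRing.Theory Num.Theory.

(** In the basis [m], Schur functions are unitriangular, hence so are the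
    P^{+-}: call their matrices again P^+ and P^-, and let A be the matrix of
    the q^+.  The Cauchy kernel shows that the matrix of the q^- is A^T, so the
    orthogonality of P^+ and P^- reads P^+ A^{-1} (P^-)^T = D with D diagonal,
    i.e. (D (P^-)^T^{-1}) A = P^+, and symmetrically for P^- after transposition:
    this is an upper triangular expansion in the q's whose diagonal is D.  A
    vector with both triangular expansions is, in the basis P^eps, supported both
    above and below lambda, hence is a multiple of P^eps_lambda.

    The invertibility of A comes from t = 0, where P^+ and P^- become the Kostka
    matrix K and A becomes the matrix H of the complete functions: all entries of
    K H K^T are nonnegative, and its diagonal is positive. *)

(** * Kostka numbers and the dominance order *)

Definition nonincreasing n (lam : n.-tuple 'I_n.+1) :=
  forall i j : 'I_n, i <= j -> tnth lam j <= tnth lam i.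

Lemma mpart_nonincreasing n r (l : mpart n r) k : nonincreasing (val l k).
Proof.
have /andP[/forallP/(_ k)/forallP dec _] := valP l.
by move=> i j ij; have /forallP/(_ j)/implyP := dec i; apply.
Qed.

Lemma card_first_rows n (lam : n.-tuple 'I_n.+1) p :
  #|[set c | in_shape lam c & c.1 < p]| = \sum_(i < n | i < p) tnth lam i.
Proof.
rewrite -sum1dep_card.
rewrite (eq_bigl (fun c : 'I_n * 'I_n => (c.1 < p) && (c.2 < tnth lam c.1))); last first.
  by move=> c; rewrite andbC.
rewrite -(pair_big_dep (fun i : 'I_n => i < p)
  (fun i j : 'I_n => j < tnth lam i) (fun _ _ => 1)) /=.
apply: eq_bigr => i _; rewrite sum1dep_card.
have le_n : tnth lam i <= n by rewrite -ltnS ltn_ord.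
have widen_inj : injective (widen_ord le_n).
  by move=> j j' /(congr1 val) /= jj'; exact: val_inj.
rewrite -[RHS]card_ord -(card_imset _ widen_inj).
apply: eq_card => j; rewrite inE; apply/idP/imsetP => [ji|[j' _ ->]] /=.
  by exists (Ordinal ji) => //; exact: val_inj.
exact: ltn_ord.
Qed.

(** Entries increase strictly down a column, and the column reaches up to row 0 because [lam] is
    nonincreasing. *)
Lemma ssyt_row_le n (lam : n.-tuple 'I_n.+1) T c :
  nonincreasing lam -> ssyt lam T -> in_shape lam c -> c.1 <= T c.
Proof.
move=> dec /andP[_ /forallP cols]; case: c => i j.
elim: {i}(nat_of_ord i) {-2}i (erefl (nat_of_ord i)) => [|i0 IH] i ii0 sh; first by rewrite /= ii0.
have i0n : i0 < n by rewrite ltnW // -ii0 ltn_ord.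
pose i' := Ordinal i0n.
have sh' : in_shape lam (i', j).
  by apply: leq_trans sh (dec i' i _); rewrite /= ii0.
have /forallP/(_ (i, j))/implyP lt := cols (i', j).
rewrite /= ii0; apply: leq_ltn_trans (IH i' erefl sh') (lt _).
by rewrite sh sh' eqxx /= ii0.
Qed.

Lemma card_small_entries n (lam nu : n.-tuple 'I_n.+1) T p :
    has_content lam T nu ->
  #|[set c | in_shape lam c & T c < p]| = \sum_(a < n | a < p) tnth nu a.
Proof.
move=> /forallP content; rewrite -sum1dep_card.
rewrite (partition_big T (fun a : 'I_n => a < p)) /=; last by move=> c /andP[].
apply: eq_bigr => a ap; rewrite sum1dep_card -(eqP (content a)).
apply: eq_card => c; rewrite !inE -andbA; congr (_ && _).
by case: eqP => [->|]; rewrite ?ap ?andbF.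
Qed.

Lemma small_entries_sub_rows n (lam : n.-tuple 'I_n.+1) T p :
    nonincreasing lam -> ssyt lam T ->
  [set c | in_shape lam c & T c < p] \subset [set c | in_shape lam c & c.1 < p].
Proof.
move=> dec ssT; apply/subsetP => c; rewrite !inE => /andP[sh Tp].
by rewrite sh (leq_ltn_trans (ssyt_row_le dec ssT sh)).
Qed.

(** Entries smaller than [p] lie in the first [p] rows; the two sums count these two sets of
    cells. *)
Lemma kostka_dominance n (lam nu : n.-tuple 'I_n.+1) p :
    nonincreasing lam -> kostka lam nu != 0 ->
  \sum_(a < n | a < p) tnth nu a <= \sum_(a < n | a < p) tnth lam a.
Proof.
move=> dec; rewrite -lt0n card_gt0 => /set0Pn[T]; rewrite inE => /andP[ssT cT].
rewrite -(card_small_entries p cT) -card_first_rows.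
exact/subset_leq_card/small_entries_sub_rows.
Qed.

(** When content equals shape, the cells with entry below [p] fill the first [p] rows, by
    cardinality. As this holds for every [p], all cells of row [i] hold [i]. *)
Lemma kostka_diag n (lam : n.-tuple 'I_n.+1) : nonincreasing lam -> kostka lam lam = 1.
Proof.
case: n lam => [|n] lam dec.
  apply: eq_card1 (finfun (fun c : 'I_0 * 'I_0 => c.1)) _ _ => T.
  rewrite !inE; apply/idP/eqP => [_|_]; first by apply/ffunP => -[[]].
  by rewrite /ssyt /has_content; repeat (apply/andP; split); apply/forallP => -[] // [].
(* Row [i] is filled with [i]; [ssyt] prescribes 0 outside the shape. *)
pose T0 : {ffun 'I_n.+1 * 'I_n.+1 -> 'I_n.+1} :=
  [ffun c => if in_shape lam c then c.1 else ord0].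
apply: (eq_card1 (x := T0)) => T; rewrite !inE; apply/andP/eqP => [[ssT cT]|->].
  apply/ffunP => c; rewrite ffunE; case: ifP => [sh|/negbT nsh]; last first.
    have /andP[/andP[/forallP/(_ c) off _] _] := ssT.
    by apply/val_inj/eqP; rewrite nsh in off.
  apply/val_inj/eqP; rewrite /= eqn_leq (ssyt_row_le dec ssT sh) andbT.
  (* With [p] one more than the row of [c], membership of [c] in the smaller set bounds its entry by
     its row. *)
  have sub := small_entries_sub_rows c.1.+1 dec ssT.
  have /eqP/setP/(_ c) : [set c0 | in_shape lam c0 & T c0 < c.1.+1] ==
      [set c0 | in_shape lam c0 & c0.1 < c.1.+1].
    by rewrite eqEcard sub (card_small_entries _ cT) card_first_rows leqnn.
  by rewrite !inE sh ltnS leqnn.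
split.
  apply/andP; split; [apply/andP; split|]; apply/forallP => c.
  - by apply/implyP => /negPf nsh; rewrite ffunE nsh.
  - apply/forallP => d; apply/implyP => /and4P[shc shd /eqP cd _].
    by rewrite !ffunE shc shd cd.
  - apply/forallP => d; apply/implyP => /and4P[shc shd _ cd].
    by rewrite !ffunE shc shd.
apply/forallP => a.
have le_n : tnth lam a <= n.+1 by rewrite -ltnS ltn_ord.
rewrite -[X in _ == X]card_ord
  -(card_imset _ (_ : injective (fun j : 'I_(tnth lam a) => (a, widen_ord le_n j)))).
  apply/eqP/eq_card => -[i j]; rewrite inE ffunE; apply/andP/imsetP.
    move=> [sh]; rewrite sh /= => /eqP ia; rewrite {i}ia in sh *.
    by exists (Ordinal sh) => //; congr (_, _); exact: val_inj.
  move=> [j' _ [-> ->]].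
  have -> : in_shape lam (a, widen_ord le_n j') by rewrite /in_shape /= ltn_ord.
  by split.
by move=> j j' [jj']; exact: val_inj.
Qed.

Lemma schurc_diag n r (l : mpart n r) : schurc l l = 1.
Proof. by rewrite /schurc big1 // => k _; apply/kostka_diag/mpart_nonincreasing. Qed.

Lemma pred_initial n (P : pred 'I_n) :
    (forall i j : 'I_n, i <= j -> P j -> P i) ->
  exists p, forall i : 'I_n, P i = (i < p).
Proof.
move=> dec; exists (\max_(i | P i) i.+1) => i; apply/idP/idP => [Pi|].
  exact: (@leq_bigmax_cond _ P (fun i => i.+1) i Pi).
apply: contraLR => nPi; rewrite -leqNgt; apply/bigmax_leqP => j Pj.
by rewrite ltnNge; apply: contra nPi => /dec; apply.
Qed.

Lemma pairwise_allpairs_fst (S T : eqType) (le : rel S) (s : seq S) (t : seq T) :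
    reflexive le -> pairwise le s ->
  pairwise (fun x y => le x.1 y.1) [seq (i, k) | i <- s, k <- t].
Proof.
move=> le_refl; elim: s => //= i s IH /andP[les ps].
rewrite pairwise_cat IH // andbT; apply/andP; split.
  apply/allrelP => _ _ /mapP[k _ ->] /allpairsP[[j k'] [js _ ->]] /=.
  exact: (allP les).
rewrite pairwise_map; elim: t {IH} => //= k t ->; rewrite andbT.
by apply/allP => k' _ /=.
Qed.

(** [cseq] reads the parts row by row, so its first [p] entries contain an initial run of each
    family, of a length [q k] independent of [l]. Dominance thus follows from dominance in each
    family. *)
Lemma sumn_take_cseq n r (p : nat) : exists q : 'I_r -> nat, forall l : mpart n r,
  sumn (take p (cseq l)) = \sum_k \sum_(i < n | i < q k) part l k i.
Proof.
pose E := [seq (i, k) | i <- enum 'I_n, k <- enum 'I_r].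
have uE : uniq E by apply: allpairs_uniq; rewrite ?enum_uniq // => -[i k] [i' k'].
have sE x : x \in E by case: x => i k; apply: allpairs_f; rewrite mem_enum.
have initial k : exists q, forall i : 'I_n, ((i, k) \in take p E) = (i < q).
  apply: pred_initial => i j ij jE; have := sE (i, k).
  rewrite -{1}(cat_take_drop p E) mem_cat => /orP[//|iE].
  (* If [(i, k)] came after the cut, sortedness would give [j <= i], hence [i = j]. *)
  have : pairwise (fun x y : 'I_n * 'I_r => x.1 <= y.1) E.
    apply: (@pairwise_allpairs_fst _ _ (fun i j : 'I_n => i <= j)) => //.
    rewrite -(pairwise_map val) val_enum_ord -sorted_pairwise; last exact: leq_trans.
    exact: iota_sorted.
  rewrite -{1}(cat_take_drop p E) pairwise_cat => /andP[/allrelP/(_ _ _ jE iE) /= ji _].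
  by rewrite (_ : i = j) //; apply/val_inj/eqP; rewrite eqn_leq ij.
have [q qE] := fin_all_exists initial.
exists q => l; have -> : cseq l = [seq part l x.2 x.1 | x <- E].
  by rewrite map_allpairs.
rewrite -map_take sumnE big_map big_uniq ?take_uniq //=.
rewrite (eq_bigl (fun x => (x.1, x.2) \in take p E)); last by case.
rewrite -(pair_big_dep xpredT (fun i k => (i, k) \in take p E) (fun i k => part l k i)) /=.
rewrite (exchange_big_dep xpredT) //=; apply: eq_bigr => k _.
by apply: eq_bigl => i; rewrite qE.
Qed.

Lemma schurc_dominated n r (l m : mpart n r) : schurc l m != 0 -> dominated m l.
Proof.
move=> nz p.
have [q qE] := sumn_take_cseq n r p; rewrite !qE; apply: leq_sum => k _.
apply: kostka_dominance; first exact: mpart_nonincreasing.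
by apply: contraNneq nz => K0; rewrite /schurc (bigD1 k) //= K0 mul0n.
Qed.

Local Open Scope ring_scope.

(** * Matrices triangular for an arbitrary total order *)

Section OrderTriangular.

Variables (K : fieldType) (N : nat) (le : rel 'I_N).
Hypotheses (le_refl : reflexive le) (le_anti : antisymmetric le)
  (le_trans : transitive le) (le_total : total le).

(** The order is a parameter so that the same lemmas, applied to the reversed relation, treat upper
    triangular matrices. *)
Definition lower (M : 'M[K]_N) := forall i j, M i j != 0 -> le j i.

Definition below (v : 'rV[K]_N) (j : 'I_N) := forall i, v 0 i != 0 -> le i j.

Lemma below_mul_lower v M j : lower M -> below v j -> below (v *m M) j.
Proof.
move=> lM vj i; rewrite mxE => nz.
have [k] : exists k, v 0 k * M k i != 0.
  apply/existsP; apply: contraNT nz; rewrite negb_exists => /forallP z.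
  by rewrite big1 // => k _; apply/eqP; rewrite -[_ == _]negbK z.
by rewrite mulf_eq0 negb_or => /andP[/vj kj /lM ik]; apply: le_trans kj.
Qed.

Lemma below_mul_lower_top v M j :
  lower M -> below v j -> (v *m M) 0 j = v 0 j * M j j.
Proof.
move=> lM vj; rewrite mxE (bigD1 j) //= big1 ?addr0 // => k kj.
apply/eqP; rewrite mulf_eq0 -[_ || _]negbK negb_or.
apply: contra kj => /andP[/vj kj /lM jk].
by apply/eqP/le_anti; rewrite kj jk.
Qed.

Lemma exists_top (v : 'rV[K]_N) : v != 0 -> exists2 j, v 0 j != 0 & below v j.
Proof.
move=> /rV0Pn[i0 vi0].
case: (@extremumP _ _ (fun x y => le y x) i0 (fun i => v 0 i != 0) id) => //.
- by move=> y x z xy yz; apply: le_trans yz xy.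
- by move=> j vj maxj; exists j => // i vi; apply: maxj.
Qed.

(** The greatest index in the support of [v] stays in the support of [v *m M]: its entry is only
    multiplied by a nonzero diagonal entry. *)
Lemma below_of_mul_lower v M j :
    lower M -> (forall i, M i i != 0) -> below (v *m M) j -> below v j.
Proof.
move=> lM dM vMj i vi.
have v0 : v != 0 by apply: contraNneq vi => ->; rewrite mxE.
have [k vk kmax] := exists_top v0.
apply: le_trans (kmax i vi) (vMj k _).
by rewrite below_mul_lower_top // mulf_neq0.
Qed.

(** A nonzero kernel vector would have a greatest index in its support, where its image is
    nonzero. *)
Lemma lower_unitmx (M : 'M[K]_N) :
  lower M -> (forall i, M i i != 0) -> M \in unitmx.
Proof.
move=> lM dM; rewrite -row_free_unit -kermx_eq0.
apply/negPn/negP => /rowV0Pn[v /sub_kermxP vM v0].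
have [k vk kmax] := exists_top v0.
have := below_mul_lower_top lM kmax.
by rewrite vM mxE => /esym/eqP; rewrite mulf_eq0 (negPf vk) (negPf (dM k)).
Qed.

End OrderTriangular.

(** * Opposite triangular expansions and a diagonal Gram matrix *)

Section TriangularPairing.

Variables (K : fieldType) (N : nat) (le : rel 'I_N).
Hypotheses (le_refl : reflexive le) (le_anti : antisymmetric le)
  (le_trans : transitive le) (le_total : total le).

Let ge : rel 'I_N := fun i j => le j i.

Lemma ge_anti : antisymmetric ge.
Proof. move=> x y; rewrite andbC; exact: le_anti. Qed.

Lemma ge_trans : transitive ge.
Proof. by move=> y x z xy yz; exact: (le_trans yz xy). Qed.

Lemma ge_total : total ge.
Proof. by move=> x y; exact: le_total. Qed.

Variables (A P P' S : 'M[K]_N) (d : 'rV[K]_N).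
Hypotheses (lP : lower le P) (lP' : lower le P') (lS : lower le S).
Hypotheses (P1 : forall i, P i i = 1) (P'1 : forall i, P' i i = 1)
  (S1 : forall i, S i i = 1).
Hypotheses (uA : A \in unitmx) (PAP' : P *m invmx A *m P'^T = diag_mx d).

Let unitri_unitmx (M : 'M[K]_N) :
  lower le M -> (forall i, M i i = 1) -> M \in unitmx.
Proof.
move=> lM M1; apply: (lower_unitmx le_refl le_anti le_trans le_total lM) => i.
by rewrite M1 oner_neq0.
Qed.

Let uP : P \in unitmx := unitri_unitmx lP P1.


Let upP'T : lower ge P'^T.
Proof. by move=> i j; rewrite mxE => /lP'. Qed.

Let P'T1 i : P'^T i i = 1.
Proof. by rewrite mxE. Qed.

(** The coordinates [w] of [c *m A] in the rows of [P] are supported below [j] by the expansion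
    through [S]. The Gram relation gives [c *m P'^T = w *m diag_mx d], so they are also supported
    above [j], as [d] has no zero entry. *)
Lemma above_below_proportional (c u : 'rV[K]_N) j :
    (forall i, d 0 i != 0) ->
    below ge c j -> below le u j -> c *m A = u *m S ->
  c *m A = u 0 j *: row j P /\ c 0 j = d 0 j * u 0 j.
Proof.
move=> d0 cj uj cAuS; pose w := c *m A *m invmx P.
have wP : w *m P = c *m A by rewrite mulmxKV.
have wd i : (c *m P'^T) 0 i = w 0 i * d 0 i.
  suff -> : c *m P'^T = w *m diag_mx d by rewrite mul_mx_diag mxE.
  by rewrite -PAP' !mulmxA wP mulmxK.
have wj : below le w j.
  apply: (below_of_mul_lower le_refl le_anti le_trans le_total lP).
    by move=> i; rewrite P1 oner_neq0.
  by rewrite wP cAuS; exact: below_mul_lower.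
have wj' : below ge w j.
  move=> i wi; apply: (below_mul_lower ge_trans upP'T cj).
  by rewrite wd mulf_neq0.
(* Compare the entries at [j] in [w *m P = u *m S], where both matrices have unit diagonal. *)
have wju : w 0 j = u 0 j.
  have := below_mul_lower_top le_anti lP wj.
  by rewrite wP cAuS (below_mul_lower_top le_anti lS uj) S1 P1 !mulr1.
have wE : w = u 0 j *: delta_mx 0 j.
  apply/rowP => i; rewrite [RHS]mxE [delta_mx _ _ _ _]mxE eqxx /=.
  have [->|ij] := eqVneq i j; first by rewrite mulr1.
  rewrite mulr0; apply/eqP; apply: contraTT ij => wi; rewrite negbK.
  by apply/eqP/le_anti/andP; split; [exact: wj | exact: wj'].
split; first by rewrite -wP wE -scalemxAl -rowE.
have := below_mul_lower_top ge_anti upP'T cj.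
by rewrite wd P'T1 mulr1 wju mulrC => <-.
Qed.

(** The Gram relation makes [c *m P'^T] a multiple of the [j]-th unit vector, and cancelling the
    upper triangular [P'^T] keeps the support above [j]. *)
Lemma proportional_above (x : K) j : exists c : 'rV[K]_N,
  [/\ below ge c j, c 0 j = d 0 j * x & c *m A = x *: row j P].
Proof.
exists (x *: row j P *m invmx A); rewrite mulmxKV //.
set c := _ *m invmx A.
have cP : c *m P'^T = (x * d 0 j) *: delta_mx 0 j.
  rewrite /c rowE -!scalemxAl -!mulmxA [P *m _]mulmxA PAP' -rowE -scalerA.
  congr (_ *: _).
  by apply/rowP => i; rewrite !mxE eqxx /= mulr_natr eq_sym.
have cj : below ge c j.
  apply: (below_of_mul_lower _ ge_anti ge_trans ge_total upP'T) => //.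
    by move=> i; rewrite P'T1 oner_neq0.
  move=> i; rewrite cP !mxE eqxx /=.
  by have [-> _|_] := eqVneq i j; [exact: le_refl | rewrite mulr0 eqxx].
split=> //; have := below_mul_lower_top ge_anti upP'T cj.
by rewrite cP !mxE !eqxx P'1 !mulr1 mulrC.
Qed.

End TriangularPairing.

(** * Values at t = 0 *)

Lemma ev0D r (p q : mpoly r) : ev0 (p + q) = ev0 p + ev0 q.
Proof. by elim: r p q => //= r IH p q; rewrite -IH; congr ev0; exact: coefD. Qed.

Lemma ev0N r (p : mpoly r) : ev0 (- p) = - ev0 p.
Proof. by elim: r p => //= r IH p; rewrite -IH; congr ev0; exact: coefN. Qed.

Lemma ev0M r (p q : mpoly r) : ev0 (p * q) = ev0 p * ev0 q.
Proof. by elim: r p q => //= r IH p q; rewrite -IH; congr ev0; exact: coef0M. Qed.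

Lemma ev00 r : ev0 (0 : mpoly r) = 0.
Proof. by elim: r => //= r IH; rewrite -[RHS]IH; congr ev0; exact: coef0. Qed.

Lemma ev01 r : ev0 (1 : mpoly r) = 1.
Proof. by elim: r => //= r IH; rewrite -[RHS]IH; congr ev0; exact: coef1. Qed.

Lemma ev0_tvar r j : ev0 (tvar r j) = 0.
Proof.
elim: r => //= r IH; case: ifP => _.
  by rewrite -[RHS](ev00 r); congr ev0; exact: coefX.
by rewrite -[RHS]IH; congr ev0; exact: coefC.
Qed.

Lemma ev0_neq0 r (g : mpoly r) : ev0 g != 0 -> tofrac g != 0.
Proof. by apply: contraNneq => /eqP; rewrite tofrac_eq0 => /eqP ->; rewrite ev00. Qed.

Lemma at0D r (a b : Qt r) x y : at0 a x -> at0 b y -> at0 (a + b) (x + y).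
Proof.
move=> [f [g [g0 -> ->]]] [f' [g' [g'0 -> ->]]].
exists (f * g' + f' * g), (g * g'); split; first by rewrite ev0M mulf_neq0.
  by rewrite rmorphD !rmorphM addf_div //; exact: ev0_neq0.
by rewrite ev0D !ev0M addf_div.
Qed.

Lemma at0M r (a b : Qt r) x y : at0 a x -> at0 b y -> at0 (a * b) (x * y).
Proof.
move=> [f [g [g0 -> ->]]] [f' [g' [g'0 -> ->]]].
exists (f * f'), (g * g'); split; first by rewrite ev0M mulf_neq0.
  by rewrite !rmorphM mulf_div.
by rewrite !ev0M mulf_div.
Qed.

Lemma at0_1 r : at0 (1 : Qt r) 1.
Proof. by exists 1, 1; rewrite !ev01 rmorph1 !divr1 oner_neq0. Qed.

Lemma at0_0 r : at0 (0 : Qt r) 0.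
Proof. by exists 0, 1; rewrite ev01 ev00 rmorph0 !mul0r oner_neq0. Qed.

Lemma at0_oppt r j : at0 (- tv j : Qt r) 0.
Proof.
exists (- tvar r j), 1.
by rewrite ev01 ev0N ev0_tvar oppr0 mul0r rmorph1 rmorphN divr1 oner_neq0.
Qed.

(** The denominator is a nonzero polynomial, so the numerator vanishes. Hence a fraction with a
    nonzero value at t = 0 is nonzero. *)
Lemma at0_eq0 r (c : rat) : at0 (0 : Qt r) c -> c = 0.
Proof.
move=> [f [g [g0 /esym/eqP]]]; rewrite mulf_eq0 invr_eq0 (negPf (ev0_neq0 g0)) orbF.
by rewrite tofrac_eq0 => /eqP -> ->; rewrite ev00 mul0r.
Qed.

(** [at0 a c] includes that [a] is regular at t = 0. Nonnegativity there is stable under sums and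
    products, so a sum with one positive term cannot cancel to 0. *)
Definition ge0_at0 r (a : Qt r) := exists2 c, at0 a c & 0 <= c.
Definition gt0_at0 r (a : Qt r) := exists2 c, at0 a c & 0 < c.

Lemma gt0_ge0_at0 r (a : Qt r) : gt0_at0 a -> ge0_at0 a.
Proof. by case=> c ac c0; exists c => //; rewrite ltW. Qed.

Lemma gt0_at0_neq0 r (a : Qt r) : gt0_at0 a -> a != 0.
Proof.
case=> c ac c0; apply: contraTneq c0 => a0; rewrite a0 in ac.
by rewrite (at0_eq0 ac) ltxx.
Qed.

Lemma gt0_at0_1 r : gt0_at0 (1 : Qt r).
Proof. by exists 1; first exact: at0_1. Qed.

Lemma ge0_at0M r (a b : Qt r) : ge0_at0 a -> ge0_at0 b -> ge0_at0 (a * b).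
Proof. by move=> [x ax x0] [y bx y0]; exists (x * y); [exact: at0M | rewrite mulr_ge0]. Qed.

Lemma ge0_at0_0 r : ge0_at0 (0 : Qt r).
Proof. by exists 0; first exact: at0_0. Qed.

Lemma ge0_at0_natr r (a : Qt r) (m : nat) : at0 a m%:R -> ge0_at0 a.
Proof. by exists m%:R. Qed.

Lemma ge0_at0_sum r (I : Type) (s : seq I) (p : pred I) (F : I -> Qt r) :
  (forall i, p i -> ge0_at0 (F i)) -> ge0_at0 (\sum_(i <- s | p i) F i).
Proof.
move=> F0; apply: (big_ind (@ge0_at0 r)) => //; first exact: ge0_at0_0.
by move=> a b [x ax x0] [y bx y0]; exists (x + y); [exact: at0D | rewrite addr_ge0].
Qed.

Lemma gt0_at0_sum r (I : finType) (p : pred I) (F : I -> Qt r) i0 :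
    p i0 -> gt0_at0 (F i0) -> (forall i, p i -> ge0_at0 (F i)) ->
  gt0_at0 (\sum_(i | p i) F i).
Proof.
move=> pi0 [x Fx x0] F0; rewrite (bigD1 i0) //=.
have [i /andP[/F0//]|y Fy y0] := @ge0_at0_sum _ _ (index_enum I) [pred i | p i & i != i0] F.
by exists (x + y); [exact: at0D | rewrite ltr_wpDr].
Qed.

Lemma ge0_at0_prod r (I : Type) (s : seq I) (p : pred I) (F : I -> Qt r) :
  (forall i, p i -> ge0_at0 (F i)) -> ge0_at0 (\prod_(i <- s | p i) F i).
Proof.
move=> F0; apply: (big_ind (@ge0_at0 r)) => //; last exact: ge0_at0M.
exact: gt0_ge0_at0 (gt0_at0_1 r).
Qed.

Lemma ge0_at0X r (a : Qt r) k : ge0_at0 a -> ge0_at0 (a ^+ k).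
Proof. by move=> a0; rewrite -[k]card_ord -prodr_const; apply: ge0_at0_prod. Qed.

(** * Coefficients of the q functions and the Cauchy kernel *)

Definition sums_to n r (T : finType) (A : {ffun T -> expo n r}) (g : expo n r) :=
  [forall d, (\sum_c A c d)%N == g d].

(** Arrays are indexed by all of [T]; forcing 0 outside [s] counts each choice of exponents for the
    factors in [s] once. *)
Definition vanishes_off n r (T : finType) (s : seq T) (A : {ffun T -> expo n r}) :=
  [forall c, (c \notin s) ==> [forall d, A c d == 0%N :> nat]].

Lemma smulE n r (f g : ser n r) (gam : expo n r) :
  smul f g gam = \sum_(a : expo n r | [forall c, (a c <= gam c)%N])
                   f a * g [ffun c => inord (gam c - a c)].
Proof. by []. Qed.

(** An iterated convolution splits [g] in all ways into exponent vectors, one per factor. In the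
    induction, the vector of the new factor is stored at index [c0], which is free because [s] has
    no repetition. *)
Lemma big_smulE n r (T : finType) (f : T -> ser n r) (s : seq T) (g : expo n r) :
    uniq s ->
  (\big[@smul n r/@sone n r]_(c <- s) f c) g =
  \sum_(A : {ffun T -> expo n r} | sums_to A g && vanishes_off s A)
    \prod_(c <- s) f c (A c).
Proof.
elim: s g => [|c0 s IHs] g.
  move=> _; rewrite big_nil /sone.
  under eq_bigr do rewrite big_nil.
  have eq0 (A : {ffun T -> expo n r}) : vanishes_off [::] A -> A = [ffun=> [ffun=> ord0]].
    move=> /forallP A0; apply/ffunP => c; apply/ffunP => d; rewrite !ffunE.
    by apply/val_inj/eqP; have /implyP/(_ isT)/forallP/(_ d) := A0 c.
  have s0 d : (\sum_c ([ffun=> [ffun=> ord0]] : {ffun T -> expo n r}) c d = 0)%N.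
    by rewrite big1 // => c _; rewrite !ffunE.
  case: ifP => [/forallP g0|/negbT]; last first.
    rewrite negb_forall => /existsP[d gd]; rewrite big1 // => A.
    move=> /andP[/forallP/(_ d) Ag /eq0 A0].
    by rewrite A0 s0 in Ag; rewrite -(eqP Ag) in gd.
  rewrite (bigD1 [ffun=> [ffun=> ord0]]) /=; last first.
    apply/andP; split; first by apply/forallP => d; rewrite s0 eq_sym.
    by apply/forallP => c; apply/forallP => d; rewrite !ffunE.
  by rewrite big1 ?addr0 // => A /andP[/andP[_ /eq0 ->]]; rewrite eqxx.
rewrite cons_uniq => /andP[c0s us]; rewrite big_cons smulE.
under [LHS]eq_bigr do rewrite (IHs _ us) big_distrr /=.
rewrite pair_big_dep /=.
(* [h] writes the vector of the new factor at [c0]; [h'] reads it back and resets that place to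
   0. *)
pose h (p : expo n r * {ffun T -> expo n r}) : {ffun T -> expo n r} :=
  [ffun c => if c == c0 then p.1 else p.2 c].
pose h' (A : {ffun T -> expo n r}) : expo n r * {ffun T -> expo n r} :=
  (A c0, [ffun c => if c == c0 then [ffun=> ord0] else A c]).
rewrite [RHS](reindex_onto h h'); last first.
  move=> A _; apply/ffunP => c; rewrite !ffunE /=.
  by case: eqP => [->|_] //; rewrite ffunE; case: eqP.
apply: eq_big => [[a A]|[a A]] /=; last first.
  move=> _; rewrite big_cons ffunE eqxx; congr (_ * _).
  apply: eq_big_seq => c cs; rewrite ffunE /= ifN //.
  by apply: contraNneq c0s => <-.
have hsum d : (\sum_c h (a, A) c d = a d + \sum_(c | c != c0) A c d)%N.
  rewrite (bigD1 c0) //= ffunE eqxx; congr (_ + _)%N.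
  by apply: eq_bigr => c /negPf cc0; rewrite ffunE cc0.
have h'h : (h' (h (a, A)) == (a, A)) = [forall d, A c0 d == 0%N :> nat].
  apply/eqP/forallP => [[_ /ffunP/(_ c0)] + d|Ac0].
    by rewrite ffunE eqxx => <-; rewrite ffunE.
  rewrite /h' /h ffunE eqxx /=; congr (_, _); apply/ffunP => c; rewrite !ffunE.
  case: eqP => [->|_] //.
  by apply/ffunP => d; rewrite ffunE; apply/val_inj; rewrite /= (eqP (Ac0 d)).
rewrite h'h /sums_to /vanishes_off; apply/idP/idP.
  move=> /andP[/forallP ag /andP[/forallP As /forallP A0]].
  have Ac0 : forall d, A c0 d = 0%N :> nat.
    by move=> d; apply/eqP; have /implyP/(_ c0s)/forallP/(_ d) := A0 c0.
  apply/andP; split; last by apply/forallP => d; rewrite Ac0.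
  apply/andP; split; apply/forallP.
    move=> d; have := As d; rewrite hsum (bigD1 c0) //= Ac0 add0n => /eqP ->.
    (* [g d - a d] is at most [n], so [inord] leaves it unchanged. *)
    by rewrite ffunE inordK ?subnKC //; exact: leq_ltn_trans (leq_subr _ _) (ltn_ord _).
  move=> c; apply/implyP; rewrite in_cons negb_or => /andP[cc0 cs].
  by have := A0 c; rewrite cs ffunE (negPf cc0).
move=> /andP[/andP[/forallP As /forallP A0] /forallP Ac0].
have ag d : (a d <= g d)%N by rewrite -(eqP (As d)) hsum leq_addr.
apply/andP; split; first exact/forallP.
apply/andP; split; apply/forallP.
  move=> d; rewrite ffunE inordK; last exact: leq_ltn_trans (leq_subr _ _) (ltn_ord _).
  rewrite -(eqP (As d)) hsum addKn (bigD1 c0) //=.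
  by rewrite (eqP (Ac0 d)).
move=> c; apply/implyP => cs; have [->|cc0] := eqVneq c c0; first exact/forallP.
by have := A0 c; rewrite in_cons negb_or cc0 cs /= ffunE (negPf cc0).
Qed.

(** Coefficient of [(u x_d)^a] in what the variable [x_d] contributes to the generating function of
    family [c.1]: a geometric series, [1 - t u x_d], or 1. Reading [u] as a second variable [y_c]
    gives a factor of the Cauchy kernel. *)
Definition qweight n r eps (c d : 'I_r * 'I_n) (a : nat) : Qt r :=
  if d.1 == c.1 then 1 else
  if d.1 == nbr eps c.1 then (if (a <= 1)%N then (- qpar eps c.1) ^+ a else 0)
  else (a == 0%N)%:R.

(** Family k-1 is the + neighbour of k exactly when k is the - neighbour of k-1, and both signs
    attach the parameter t_{k-1} to this pair. *)
Lemma qweight_tr n r (c d : 'I_r * 'I_n) a : qweight true c d a = qweight false d c a.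
Proof.
rewrite /qweight eq_sym; case: eqP => // _.
have -> : (d.1 == nbr true c.1) = (c.1 == nbr false d.1).
  by rewrite /=; apply/eqP/eqP => ->; rewrite ?ord_predK ?ordSK.
by case: eqP => // ->; rewrite /qpar /= ordSK.
Qed.

Lemma qweight0 n r eps (c d : 'I_r * 'I_n) : qweight eps c d 0 = 1.
Proof. by rewrite /qweight; do 2![case: ifP => // _]. Qed.

Lemma qweight_diag n r eps (c : 'I_r * 'I_n) a : qweight eps c c a = 1.
Proof. by rewrite /qweight eqxx. Qed.

(** Every weight takes the value 0 or 1 at t = 0. *)
Lemma ge0_at0_qweight n r eps (c d : 'I_r * 'I_n) a : ge0_at0 (qweight eps c d a).
Proof.
have ge0_1 := gt0_ge0_at0 (gt0_at0_1 r).
have ge0_t j : ge0_at0 (- tv j : Qt r) by exists 0 => //; exact: at0_oppt.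
rewrite /qweight; case: ifP => // _; case: ifP => _; last first.
  by case: (a == 0%N) => //; exact: ge0_at0_0.
by case: ifP => _; [apply: ge0_at0X; exact: ge0_t | exact: ge0_at0_0].
Qed.

(** A fixed point of the cyclic shift would wrap around to 0, forcing r = 1. Hence numerator and
    denominator of the generating function involve different variables. *)
Lemma nbr_neq r eps (k : 'I_r) : (1 < r)%N -> nbr eps k != k.
Proof.
move=> r1; have oS (j : 'I_r) : ordS j != j.
  apply/eqP => /(congr1 val) /=; have := ltn_ord j.
  rewrite leq_eqVlt => /predU1P[jr|jr]; last by rewrite modn_small // => /esym/n_Sn.
  by rewrite jr modnn => j0; rewrite -jr -j0 in r1.
case: eps => //=; apply: contraNneq (oS k) => {1}<-.
by rewrite ord_predK.
Qed.

(** The generating function is a product over the variables, so its coefficients are products of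
    weights; the support conditions of [qfac] become vanishing weights. *)
Lemma qfacE n r eps (c : 'I_r * 'I_n) s (a : expo n r) : (1 < r)%N ->
  qfac eps c.1 (qpar eps c.1) s a =
  if (\sum_d a d == s)%N then \prod_d qweight eps c d (a d) else 0.
Proof.
move=> r1; rewrite /qfac; set k := c.1; set kk := nbr eps k.
have kkk : kk != k by exact: nbr_neq.
have wE d x : qweight eps c d x = if d.1 == k then 1 else
    if d.1 == kk then (if (x <= 1)%N then (- qpar eps k) ^+ x else 0)
    else (x == 0%N)%:R by [].
have [/forallP supp|] := boolP [forall d : 'I_r * 'I_n,
    (d.1 != k) && (d.1 != kk) ==> (nat_of_ord (a d) == 0%N)]; last first.
  rewrite negb_forall => /existsP[d]; rewrite negb_imply => /andP[/andP[dk dkk] ad].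
  rewrite [\prod_d _](bigD1 d) //= wE (negPf dk) (negPf dkk) (negPf ad) mul0r.
  by case: ifP.
have [/forallP le1|] := boolP [forall i : 'I_n, (a (kk, i) <= 1)%N]; last first.
  rewrite negb_forall => /existsP[i ai].
  by rewrite [\prod_d _](bigD1 (kk, i)) //= wE /= (negPf kkk) eqxx (negPf ai) mul0r; case: ifP.
have off j i : j != k -> j != kk -> a (j, i) = 0%N :> nat.
  by move=> jk jkk; apply/eqP; have /implyP := supp (j, i); apply; rewrite jk.
have -> : (\sum_d a d = \sum_(i < n) a (kk, i) + \sum_(i < n) a (k, i))%N.
  rewrite (eq_bigr (fun d => a (d.1, d.2) : nat)); last by case.
  rewrite -(pair_bigA _ (fun j i => a (j, i) : nat)) /=.
  rewrite (bigD1 kk) //= (bigD1 k) 1?eq_sym //= [X in (_ + (_ + X))%N]big1 ?addn0 //.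
  by move=> j /andP[jkk jk]; rewrite big1 // => i _; rewrite off.
rewrite /=; case: ifP => // _.
rewrite (eq_bigr (fun d => qweight eps c (d.1, d.2) (a (d.1, d.2)))); last by case.
rewrite -(pair_bigA _ (fun j i => qweight eps c (j, i) (a (j, i)))) /=.
rewrite (bigD1 kk) //= [X in _ * X]big1 ?mulr1.
  rewrite -prodrXr; apply: eq_bigr => i _.
  by rewrite wE /= (negPf kkk) eqxx le1.
move=> j jkk; rewrite big1 // => i _; have [->|jk] := eqVneq j k.
  by rewrite wE eqxx.
by rewrite off // qweight0.
Qed.

(** A weighted count of nonnegative integer matrices with row sums [l] and column sums [m], as for
    the monomial expansion of complete functions. *)
Lemma qserE n r eps (l m : mpart n r) : (1 < r)%N ->
  qser eps l (expo_of m) =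
  \sum_(A : {ffun 'I_r * 'I_n -> expo n r} |
         [forall c, (\sum_d A c d == part l c.1 c.2)%N]
         && [forall d, (\sum_c A c d == part m d.1 d.2)%N])
    \prod_c \prod_d qweight eps c d (A c d).
Proof.
move=> r1; rewrite /qser big_smulE ?index_enum_uniq //.
rewrite [LHS](bigID (fun A : {ffun 'I_r * 'I_n -> expo n r} =>
  [forall c, (\sum_d A c d == part l c.1 c.2)%N])) /=.
(* An array with a wrong row sum contributes 0, by the degree condition in [qfac]. *)
rewrite [X in _ + X]big1 ?addr0; last first.
  move=> A /andP[_]; rewrite negb_forall => /existsP[c Ac].
  by rewrite (bigD1 c) //= qfacE // (negPf Ac) mul0r.
apply: eq_big => [A|A /andP[_ /forallP Al]]; last first.
  by apply: eq_bigr => c _; rewrite qfacE // Al.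
have -> : vanishes_off (index_enum ('I_r * 'I_n)%type) A.
  by apply/forallP => c; rewrite mem_index_enum.
rewrite andbT andbC; congr (_ && _).
by apply: eq_forallb => d; rewrite ffunE.
Qed.

(* Both sides are the coefficient of x^m y^l in the Cauchy kernel
   prod (1 - t_{k-1} x^{(k-1)}_i y^{(k)}_j) / (1 - x^{(k)}_i y^{(k)}_j). *)
Lemma qfun_sym n r (l m : mpart n r) : (1 < r)%N ->
  qfun true l m = qfun false m l.
Proof.
move=> r1; rewrite !ffunE !qserE //.
pose tr (A : {ffun 'I_r * 'I_n -> expo n r}) : {ffun 'I_r * 'I_n -> expo n r} :=
  [ffun c => [ffun d => A d c]].
have trK : involutive tr by move=> A; apply/ffunP => c; apply/ffunP => d; rewrite !ffunE.
rewrite [LHS](reindex_inj (inv_inj trK)) /=; apply: eq_big => A.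
  rewrite andbC; congr (_ && _); apply: eq_forallb => c.
    by under eq_bigr do rewrite !ffunE.
  by under eq_bigr do rewrite !ffunE.
move=> _; rewrite exchange_big; apply: eq_bigr => c _; apply: eq_bigr => d _.
by rewrite !ffunE qweight_tr.
Qed.

Lemma ge0_at0_qfun n r eps (l m : mpart n r) : (1 < r)%N -> ge0_at0 (qfun eps l m).
Proof.
move=> r1; rewrite ffunE qserE //; apply: ge0_at0_sum => A _.
by do 2![apply: ge0_at0_prod => ? _]; exact: ge0_at0_qweight.
Qed.

Lemma gt0_at0_qfun n r eps (l : mpart n r) : (1 < r)%N -> gt0_at0 (qfun eps l l).
Proof.
move=> r1; rewrite ffunE qserE //.
(* The diagonal matrix with entries [l] has both margins [l] and weight 1. *)
pose D : {ffun 'I_r * 'I_n -> expo n r} :=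
  [ffun c => [ffun d => if c == d then tnth (val l c.1) c.2 else ord0]].
apply: (@gt0_at0_sum _ _ _ _ D) => [||A _].
- apply/andP; split; apply/forallP => c; rewrite (bigD1 c) //= !ffunE eqxx big1 ?addn0 //.
    by move=> d dc; rewrite !ffunE eq_sym (negPf dc).
  by move=> d dc; rewrite !ffunE (negPf dc).
- rewrite big1 => [|c _]; first exact: gt0_at0_1.
  rewrite big1 // => d _; rewrite !ffunE; case: eqP => [->|_].
    exact: qweight_diag.
  exact: qweight0.
by do 2![apply: ge0_at0_prod => ? _]; exact: ge0_at0_qweight.
Qed.

(** * Coordinates in the monomial basis *)

Section Coordinates.

Variables n r : nat.

Definition rowof (F : mpart n r -> Qt r) : 'rV[Qt r]_(Nm n r) :=
  \row_j F (enum_val j).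

Definition mxof (B : mpart n r -> Xi n r) : 'M[Qt r]_(Nm n r) :=
  \matrix_(i, j) B (enum_val i) (enum_val j).

Lemma rowof_inj (F G : Xi n r) : rowof F = rowof G -> F = G.
Proof.
move=> /rowP FG; apply/ffunP => nu; have := FG (enum_rank nu).
by rewrite !mxE enum_rankK.
Qed.

Lemma rowof_enum_rank (v : 'rV[Qt r]_(Nm n r)) :
  rowof (fun nu => v 0 (enum_rank nu)) = v.
Proof. by apply/rowP => j; rewrite mxE enum_valK. Qed.

Lemma sum_enum_val (F : mpart n r -> Qt r) :
  \sum_nu F nu = \sum_(i < Nm n r) F (enum_val i).
Proof. exact: (reindex (fun i : 'I_(Nm n r) => enum_val i) (onW_bij _ (enum_val_bij _))). Qed.

Lemma rowof_lincomb c B : rowof (lincomb c B) = rowof c *m mxof B.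
Proof.
apply/rowP => j; rewrite !mxE ffunE sum_enum_val.
by apply: eq_bigr => i _; rewrite !mxE.
Qed.

Lemma row_mxof B i : row i (mxof B) = rowof (B (enum_val i)).
Proof. by apply/rowP => j; rewrite !mxE. Qed.

(** The identity is formal: it also holds with the default value of [invmx], which the proof that
    [qmat] is invertible relies on. *)
Lemma form_mxE Pp Pm (i j : 'I_(Nm n r)) :
  (mxof Pp *m invmx (qmat n r) *m (mxof Pm)^T) i j =
  Defs.form (Pp (enum_val i)) (Pm (enum_val j)).
Proof.
rewrite mxE /Defs.form sum_enum_val; apply: eq_bigr => k _.
rewrite !mxE /qcoord enum_valK !mxE; congr (_ * _).
by apply: eq_bigr => h _; rewrite !mxE.
Qed.

Lemma mxof_qfun eps : (1 < r)%N ->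
  mxof (qfun eps) = if eps then qmat n r else (qmat n r)^T.
Proof.
by move=> r1; case: eps; apply/matrixP => i j; rewrite !mxE // qfun_sym.
Qed.

End Coordinates.

(** * Triangularity and Gram matrix of the Hall-Littlewood functions *)

Section HallLittlewood.

Variables (n r : nat) (r1 : (1 < r)%N) (ord : rel (mpart n r)).
Hypothesis ordP : total_refining ord.
Variables Pp Pm : mpart n r -> Xi n r.
Hypothesis HP : is_HL ord Pp Pm.

Let le : rel 'I_(Nm n r) := fun i j => ord (enum_val i) (enum_val j).

Let le_refl : reflexive le.
Proof. by case: ordP => orefl _ _ _ _ i; exact: orefl. Qed.

Let le_anti : antisymmetric le.
Proof. by case: ordP => _ oanti _ _ _ i j /oanti/enum_val_inj. Qed.

Let le_trans : transitive le.
Proof. by case: ordP => _ _ otrans _ _ j i k; exact: otrans. Qed.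

Let le_total : total le.
Proof. by case: ordP => _ _ _ ototal _ i j; exact: ototal. Qed.

Let S := mxof (@schur n r).
Let P eps := mxof (HLsel Pp Pm eps).
Let d : 'rV[Qt r]_(Nm n r) := rowof (fun l => Defs.form (Pp l) (Pm l)).

Lemma lower_schur : lower le S.
Proof.
case: ordP => _ _ _ _ dom_ord i j; rewrite mxE ffunE => nz.
by apply/dom_ord/schurc_dominated; apply: contraNneq nz => ->.
Qed.

Lemma schur_diag i : S i i = 1.
Proof. by rewrite mxE ffunE schurc_diag. Qed.

Lemma HL_expansion eps i : exists u : 'rV[Qt r]_(Nm n r),
  [/\ below le u i, u 0 i = 1 & row i (P eps) = u *m S].
Proof.
case: HP => /(_ eps (enum_val i))[u [_ u1 uord E]] _ _.
exists (rowof u); split; last by rewrite row_mxof E rowof_lincomb.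
  by move=> j; rewrite mxE => /uord.
by rewrite mxE.
Qed.

(** Two triangular transitions compose: from P to Schur functions, then to monomials. *)
Lemma lower_HL eps : lower le (P eps).
Proof.
move=> i j; have [u [ui _ E]] := HL_expansion eps i.
have -> : P eps i j = row i (P eps) 0 j by rewrite [RHS]mxE.
by rewrite E; exact: (below_mul_lower le_trans lower_schur ui).
Qed.

Lemma HL_diag eps i : P eps i i = 1.
Proof.
have [u [ui u1 E]] := HL_expansion eps i.
have -> : P eps i i = row i (P eps) 0 i by rewrite [RHS]mxE.
by rewrite E (below_mul_lower_top le_anti lower_schur ui) u1 schur_diag mulr1.
Qed.

Lemma unitmx_HL eps : P eps \in unitmx.
Proof.
apply: (lower_unitmx le_refl le_anti le_trans le_total (@lower_HL eps)) => i.
by rewrite HL_diag oner_neq0.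
Qed.

Lemma HL_gram : P true *m invmx (qmat n r) *m (P false)^T = diag_mx d.
Proof.
apply/matrixP => i j; rewrite form_mxE !mxE; have [->|ij] := eqVneq i j => //.
by case: HP => _ ortho _; apply: ortho; rewrite (inj_eq enum_val_inj).
Qed.

Lemma ge0_at0_HL eps i j : ge0_at0 (P eps i j).
Proof. by case: HP => _ _ at0P; rewrite mxE; exact: ge0_at0_natr (at0P _ _ _). Qed.

(* At t = 0 the (i, i) entry is a sum of natural numbers in which the term
   with all three indices equal to i is positive. *)
Lemma gt0_at0_HL_qmat_HL i :
  gt0_at0 ((P true *m qmat n r *m (P false)^T) i i).
Proof.
have qge0 j k : ge0_at0 (qmat n r j k) by rewrite mxE; exact: ge0_at0_qfun.
have Pq0 j : ge0_at0 ((P true *m qmat n r) i j).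
  rewrite mxE; apply: ge0_at0_sum => k _.
  by apply: ge0_at0M => //; exact: ge0_at0_HL.
rewrite mxE; apply: (@gt0_at0_sum _ _ _ _ i) => // [|j _]; last first.
  by rewrite [_^T _ _]mxE; apply: ge0_at0M => //; exact: ge0_at0_HL.
rewrite [_^T _ _]mxE HL_diag mulr1 mxE.
apply: (@gt0_at0_sum _ _ _ _ i) => // [|j _].
  by rewrite HL_diag mul1r mxE; exact: gt0_at0_qfun.
by apply: ge0_at0M => //; exact: ge0_at0_HL.
Qed.

(* [invmx] is the identity on singular matrices, so if [qmat] were singular
   then [HL_gram] would say that P+ qmat (P-)^T is diagonal. *)
Lemma unitmx_qmat : qmat n r \in unitmx.
Proof.
have [//|sing] := boolP (qmat n r \in unitmx); have := HL_gram.
rewrite /invmx (negPf sing) => gram.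
have : P true *m qmat n r *m (P false)^T \in unitmx.
  rewrite gram unitmxE det_diag unitfE; apply/prodf_neq0 => i _.
  have := gt0_at0_neq0 (gt0_at0_HL_qmat_HL i).
  by rewrite gram mxE eqxx.
by rewrite !unitmx_mul unitmx_tr !unitmx_HL andbT (negPf sing).
Qed.

(** The Gram matrix is diagonal and a product of invertible matrices. *)
Lemma HL_norm_neq0 i : d 0 i != 0.
Proof.
have : P true *m invmx (qmat n r) *m (P false)^T \in unitmx.
  by rewrite !unitmx_mul unitmx_inv unitmx_tr !unitmx_HL unitmx_qmat.
by rewrite HL_gram unitmxE det_diag unitfE => /prodf_neq0; apply.
Qed.

Lemma unitmx_qfun eps : mxof (@qfun n r eps) \in unitmx.
Proof. by rewrite mxof_qfun //; case: eps; rewrite ?unitmx_tr unitmx_qmat. Qed.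

(** For [eps = false] this is the transpose of [HL_gram], as the matrix of the q^- is the transpose
    of that of the q^+. *)
Lemma HL_gram_eps eps :
  P eps *m invmx (mxof (@qfun n r eps)) *m (P (~~ eps))^T = diag_mx d.
Proof.
rewrite mxof_qfun //; case: eps; first exact: HL_gram.
rewrite -[RHS]tr_diag_mx -HL_gram !trmx_mul trmxK trmx_inv.
by rewrite mulmxA.
Qed.

(** Handles both normalizations at once: for the multiple [x] of P the diagonal Schur coefficient is
    [x] and the diagonal q coefficient is [x] times the pairing of P^+ with P^-. *)
Lemma cond_i_iiE eps l F (norm1 norm2 : Qt r -> Prop) :
  cond_i ord eps l F norm1 /\ cond_ii ord l F norm2 <->
  exists x, [/\ F = [ffun nu => x * HLsel Pp Pm eps l nu],
                norm1 (Defs.form (Pp l) (Pm l) * x) & norm2 x].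
Proof.
set j := enum_rank l; have jl : enum_val j = l by exact: enum_rankK.
have dj : d 0 j = Defs.form (Pp l) (Pm l) by rewrite mxE jl.
have rowPE x : rowof [ffun nu => x * HLsel Pp Pm eps l nu] = x *: row j (P eps).
  by apply/rowP => k; rewrite !mxE ffunE jl.
split=> [[[c [cl c1 Fc]] [u [ul u1 Fu]]]|[x [-> x1 x2]]].
  have cj : below (fun a b => le b a) (rowof c) j.
    by move=> i; rewrite mxE /le jl => /cl.
  have uj : below le (rowof u) j by move=> i; rewrite mxE /le jl => /ul.
  have cuE : rowof c *m mxof (qfun eps) = rowof u *m S.
    by rewrite -!rowof_lincomb -Fc -Fu.
  have [cE cd] := above_below_proportional le_refl le_anti le_trans le_total
    (@lower_HL eps) (@lower_HL (~~ eps)) lower_schur (HL_diag eps)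
    (HL_diag (~~ eps)) schur_diag (unitmx_qfun eps) (HL_gram_eps eps)
    HL_norm_neq0 cj uj cuE.
  have uE : rowof u 0 j = u l by rewrite mxE jl.
  have {}cd : c l = Defs.form (Pp l) (Pm l) * u l by rewrite -dj -uE -cd mxE jl.
  exists (u l); rewrite -cd; split=> //.
  by apply: rowof_inj; rewrite rowPE -uE -cE -rowof_lincomb -Fc.
(* Conversely, the q expansion comes from the Gram relation, and the Schur expansion is that of P
   scaled by [x]. *)
have [c [cj cd cE]] := proportional_above le_refl le_anti le_trans le_total
  (@lower_HL (~~ eps)) (HL_diag (~~ eps)) (unitmx_qfun eps) (HL_gram_eps eps) x j.
have [u [uj u1 uE]] := HL_expansion eps j.
have ordE m : ord m l = le (enum_rank m) j by rewrite /le jl enum_rankK.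
have ordE' m : ord l m = le j (enum_rank m) by rewrite /le jl enum_rankK.
split.
  exists (fun nu => c 0 (enum_rank nu)); split; last 1 first.
  - by apply: rowof_inj; rewrite rowof_lincomb rowof_enum_rank rowPE cE.
  - by move=> m /cj; rewrite ordE'.
  - by rewrite -/j cd dj.
exists (fun nu => x * u 0 (enum_rank nu)); split; last 1 first.
- apply: rowof_inj; rewrite rowof_lincomb rowPE uE scalemxAl; congr (_ *m _).
  by apply/rowP => k; rewrite !mxE enum_valK.
- by move=> m; rewrite mulf_eq0 negb_or => /andP[_ /uj]; rewrite ordE.
- by rewrite -/j u1 mulr1.
Qed.

End HallLittlewood.

Theorem theorem2p14 (n r : nat) (hr : (2 <= r)%N)
  (ord : rel (mpart n r)) (hord : total_refining ord)
  (Pp Pm : mpart n r -> Xi n r) (HP : is_HL ord Pp Pm)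
  (eps : bool) (l : mpart n r) :
  (forall F : Xi n r,
     (cond_i ord eps l F (fun c => c != 0) /\ cond_ii ord l F (fun u => u = 1))
     <-> F = HLsel Pp Pm eps l)
  /\
  (forall F : Xi n r,
     (cond_i ord eps l F (fun c => c = 1) /\ cond_ii ord l F (fun u => u != 0))
     <-> F = QHL Pp Pm eps l).
Proof.
have b0 : Defs.form (Pp l) (Pm l) != 0.
  by have := HL_norm_neq0 hr hord HP (enum_rank l); rewrite mxE enum_rankK.
split=> F; apply: (iff_trans (cond_i_iiE hr hord HP _ _ _ _ _)); split.
- by move=> [x [-> _ ->]]; apply/ffunP => nu; rewrite ffunE mul1r.
- move=> ->; exists 1; rewrite mulr1; split=> //.
  by apply/ffunP => nu; rewrite ffunE mul1r.
(* [bx] says that [x] times the pairing of P^+ with P^- is 1, so [x] is [bHL]. *)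
- move=> [x [-> bx _]]; rewrite /QHL /bHL; apply/ffunP => nu; rewrite !ffunE.
  by rewrite -[x](mulKf b0) bx mulr1.
- by move=> ->; exists (bHL Pp Pm l); rewrite mulfV ?invr_neq0.
Qed.
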